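(* For all integers $r \ge 4$ and $\ell \ge 10$ there exists a rank-$r$ matroid $M$ with no $U_{2,\ell+2}$-minor and with more than $\frac{\ell^r-1}{\ell-1}$ hyperplanes.
   Context: Matroids are finite. $U_{2,n}$ denotes the rank-$2$ uniform matroid on $n$ elements; a matroid has no $U_{2,n}$-minor if no minor of it is isomorphic to $U_{2,n}$. A hyperplane of a rank-$r$ matroid is a flat of rank $r-1$. *)

(* Defs.v *)
From mathcomp Require Import all_boot.

Set Implicit Arguments.
Unset Strict Implicit.
Unset Printing Implicit Defensive.

(* The ground set is a subset of the finite type T, so that the minors of a
   matroid live over the same type T. *)
Record matroid (T : finType) := Matroid {
  ground : {set T};
  indep : pred {set T};
  indep_ground : forall I : {set T}, indep I -> I \subset ground;
  indep0 : indep set0;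
  indepS : forall I J : {set T}, I \subset J -> indep J -> indep I;
  indep_aug : forall I J : {set T}, indep I -> indep J -> #|I| < #|J| ->
    exists2 x, x \in J :\: I & indep (x |: I)
}.

Section Rank.
Variables (T : finType) (M : matroid T).
Implicit Types (A B C I J X : {set T}).

Definition rk X : nat := \max_(I : {set T} | indep M I && (I \subset X)) #|I|.

Definition rank : nat := rk (ground M).

Definition closure X : {set T} :=
  [set x in ground M | rk (x |: X) == rk X].

Definition flat X : bool := closure X == X.

Definition hyperplanes : {set {set T}} :=
  [set H | flat H & (rk H).+1 == rank].

Lemma leq_rk I X : indep M I -> I \subset X -> #|I| <= rk X.
Proof.
move=> iI sIX.
by apply: (bigmax_sup I) => //; rewrite iI.
Qed.

Lemma rk_basis X : exists I, [/\ indep M I, I \subset X & #|I| = rk X].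
Proof.
have P0 : indep M set0 && (set0 \subset X) by rewrite indep0 sub0set.
rewrite /rk (bigmax_eq_arg set0) //.
by case: arg_maxnP => // I /andP[iI sIX] _; exists I.
Qed.

Lemma indep_extend I X : indep M I -> I \subset X ->
  exists J, [/\ indep M J, I \subset J, J \subset X & #|J| = rk X].
Proof.
move=> iI sIX; have [n le_n] := ubnP (rk X - #|I|).
elim: n I iI sIX le_n => // n IHn I iI sIX le_n.
have [K [iK sKX cK]] := rk_basis X.
have := leq_rk iI sIX; rewrite leq_eqVlt => /orP[/eqP eI | ltI].
  by exists I.
have [|x /setDP[xK xI] ixI] := indep_aug iI iK; first by rewrite cK.
have [||J [iJ sJ sJX cJ]] := IHn (x |: I) ixI.
- by rewrite subUset sub1set sIX (subsetP sKX).
- by rewrite cardsU1 xI add1n -ltnS (leq_trans _ le_n) // ltnS subnSK.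
by exists J; split=> //; apply: subset_trans sJ; apply: subsetUr.
Qed.

Lemma indep_contractE C B I :
  indep M B -> B \subset C -> #|B| = rk C -> [disjoint I & C] ->
  (rk (I :|: C) == #|I| + rk C) = indep M (I :|: B).
Proof.
move=> iB sBC cB dIC; apply/eqP/idP => [eI | iIB].
  have [|K [iK sBK sK cK]] := @indep_extend B (I :|: C) iB.
    by rewrite (subset_trans sBC) ?subsetUr.
  suff -> : I :|: B = K by [].
  apply/esym/eqP; rewrite eqEcard cK eI -cB cardsU leq_subr andbT.
  have KC : K :&: C = B.
    apply/esym/eqP; rewrite eqEcard subsetI sBK sBC cB.
    by rewrite leq_rk ?subsetIr // (indepS (subsetIl _ _) iK).
  apply/subsetP=> x xK; rewrite inE -KC inE xK /=.
  by have := subsetP sK _ xK; rewrite inE.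
have dIB : [disjoint I & B] := disjointWr sBC dIC.
have cIB : #|I :|: B| = #|I| + #|B| by rewrite cardsU disjoint_setI0 ?cards0 ?subn0.
apply/eqP; rewrite eqn_leq -{2}cB -cIB leq_rk ?setUS // andbT.
have [K [iK sK <-]] := rk_basis (I :|: C).
have sKU : K \subset I :|: (K :&: C).
  apply/subsetP=> x xK; rewrite !inE xK /=.
  by have := subsetP sK _ xK; rewrite inE.
apply: leq_trans (subset_leq_card sKU) _.
apply: leq_trans (leq_card_setU _ _) _.
by rewrite leq_add2l leq_rk ?subsetIr // (indepS (subsetIl _ _) iK).
Qed.

End Rank.

Section Minors.
Variables (T : finType) (M : matroid T).
Implicit Types (C D I J : {set T}).

Definition delete_indep D : pred {set T} :=
  fun I => (I \subset ground M :\: D) && indep M I.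

Lemma delete_ground D I : delete_indep D I -> I \subset ground M :\: D.
Proof. by case/andP. Qed.

Lemma delete_indep0 D : delete_indep D set0.
Proof. by rewrite /delete_indep sub0set indep0. Qed.

Lemma delete_indepS D I J :
  I \subset J -> delete_indep D J -> delete_indep D I.
Proof.
move=> sIJ /andP[sJ iJ].
by rewrite /delete_indep (subset_trans sIJ sJ) (indepS sIJ iJ).
Qed.

Lemma delete_aug D I J :
  delete_indep D I -> delete_indep D J -> #|I| < #|J| ->
  exists2 x, x \in J :\: I & delete_indep D (x |: I).
Proof.
move=> /andP[sI iI] /andP[sJ iJ] /(indep_aug iI iJ)[x xJI ix].
exists x => //; case/setDP: xJI => xJ _.
by rewrite /delete_indep ix subUset sub1set (subsetP sJ) ?sI.
Qed.

Definition delete D : matroid T :=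
  Matroid (@delete_ground D) (delete_indep0 D) (@delete_indepS D)
    (@delete_aug D).

(* M / C has rank function X |-> rk (X :|: C) - rk C; a set is independent
   when its cardinality equals its rank. *)
Definition contract_indep C : pred {set T} :=
  fun I => (I \subset ground M :\: C) && (rk M (I :|: C) == #|I| + rk M C).

Lemma contract_ground C I : contract_indep C I -> I \subset ground M :\: C.
Proof. by case/andP. Qed.

Lemma contract_indep0 C : contract_indep C set0.
Proof. by rewrite /contract_indep sub0set set0U cards0 add0n eqxx. Qed.

Lemma contract_indepP C : exists2 B : {set T}, B \subset C &
  forall I, contract_indep C I = (I \subset ground M :\: C) && indep M (I :|: B).
Proof.
have [B [iB sB cB]] := rk_basis M C; exists B => // I.
rewrite /contract_indep; case: (boolP (I \subset _)) => //= sI.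
by apply: indep_contractE => //; move: sI; rewrite subsetD => /andP[].
Qed.

Lemma contract_indepS C I J :
  I \subset J -> contract_indep C J -> contract_indep C I.
Proof.
have [B _ E] := contract_indepP C; rewrite !E => sIJ /andP[sJ iJ].
by rewrite (subset_trans sIJ sJ) (indepS _ iJ) ?setSU.
Qed.

Lemma contract_aug C I J :
  contract_indep C I -> contract_indep C J -> #|I| < #|J| ->
  exists2 x, x \in J :\: I & contract_indep C (x |: I).
Proof.
have [B sB E] := contract_indepP C; rewrite !E => /andP[sI iI] /andP[sJ iJ] lt.
have cU (K : {set T}) : K \subset ground M :\: C -> #|K :|: B| = #|K| + #|B|.
  rewrite subsetD => /andP[_ dK].
  by rewrite cardsU disjoint_setI0 ?cards0 ?subn0 // (disjointWr sB).
have [|x] := indep_aug iI iJ; first by rewrite !cU // ltn_add2r.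
rewrite !inE negb_or => /andP[/andP[xI xB]]; rewrite (negPf xB) orbF => xJ ix.
exists x; first by rewrite inE xI.
by rewrite E -setUA ix subUset sub1set (subsetP sJ) ?sI.
Qed.

Definition contract C : matroid T :=
  Matroid (@contract_ground C) (contract_indep0 C) (@contract_indepS C)
    (@contract_aug C).

End Minors.

Section Uniform.
Variables k n : nat.
Implicit Types I J : {set 'I_n}.

Definition uniform_indep : pred {set 'I_n} := fun I => #|I| <= k.

Lemma uniform_ground I : uniform_indep I -> I \subset [set: 'I_n].
Proof. by rewrite subsetT. Qed.

Lemma uniform_indep0 : uniform_indep set0.
Proof. by rewrite /uniform_indep cards0. Qed.

Lemma uniform_indepS I J : I \subset J -> uniform_indep J -> uniform_indep I.
Proof. by move=> /subset_leq_card; apply: leq_trans. Qed.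

Lemma uniform_aug I J : uniform_indep I -> uniform_indep J -> #|I| < #|J| ->
  exists2 x, x \in J :\: I & uniform_indep (x |: I).
Proof.
move=> _ kJ ltIJ; have /subsetPn[x xJ xI] : ~~ (J \subset I).
  by apply: contraL ltIJ => /subset_leq_card; rewrite -leqNgt.
exists x; first by rewrite inE xI.
by rewrite /uniform_indep cardsU1 xI (leq_trans ltIJ).
Qed.

Definition uniform : matroid 'I_n :=
  Matroid uniform_ground uniform_indep0 uniform_indepS uniform_aug.

End Uniform.

Definition isomorphic (T U : finType) (M : matroid T) (N : matroid U) : Prop :=
  exists2 f : {x | x \in ground M} -> {y | y \in ground N},
    bijective f &
    forall X : {set {x | x \in ground M}},
      indep M [set val x | x in X] = indep N [set val (f x) | x in X].

(* Deletions and contractions commute, so every minor is obtained by one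
   contraction followed by one deletion. *)
Definition has_minor (T U : finType) (M : matroid T) (N : matroid U) : Prop :=
  exists C D : {set T},
    [/\ C \subset ground M, D \subset ground M, [disjoint C & D] &
        isomorphic (delete (contract M C) D) N].

(* Main.v *)
Require Import Defs.
From mathcomp Require Import all_boot all_order all_algebra.
From mathcomp Require Import zify ring.

(* A line of a rank-2 minor lifts to a corank-2 flat of M, so M has no
   U_{2,l+2}-minor as soon as every corank-2 flat lies in at most l+1
   hyperplanes.

   Parallel connection, at a fixed point p, with an (l+1)-point line through p
   preserves this property, raises the rank by one, and multiplies by l the
   number of hyperplanes avoiding p. Hence it suffices to find a rank-4 matroid
   with a point p that is avoided by at least l^3 + l^2 + l + 2 hyperplanes.

   For that, let x_1, ..., x_k in a ring R with s elements have pairwise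
   invertible differences. Take p together with k concurrent lines through p,
   the i-th one being {p} + {i} * R; the planes are the unions of two of these
   lines, the graphs over x_1, ..., x_k of the quadratic polynomials with nonzero
   leading coefficient, and all other transversal triples. Every transversal
   triple lies on exactly one quadratic graph, and those on graphs of affine
   functions are planes by themselves. A transversal pair is in s - 1 graphs,
   k - 2 triples and one union of two lines, so l = s + k - 3 is admissible, and
   s^2 (s - 1) + s^2 C(k,3) planes avoid p. *)

Set Implicit Arguments.
Unset Strict Implicit.
Unset Printing Implicit Defensive.

Import GRing.Theory Num.Theory.

(** * Corank-2 flats and uniform minors of rank 2 *)

Section CorankTwo.
Variables (T : finType) (M : matroid T).
Implicit Types (A B C H I S X : {set T}).

(* [A] spans a corank-2 flat, and the elements of [S] represent distinct
   hyperplanes through it. *)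
Definition corank2_bound (m : nat) : Prop :=
  forall A S : {set T}, #|A|.+2 = rank M -> [disjoint S & A] ->
    {in S &, forall z w, z != w -> indep M (z |: (w |: A))} -> #|S| <= m.

Lemma leq_card_rank I : indep M I -> #|I| <= rank M.
Proof. by move=> iI; apply: leq_rk => //; apply: indep_ground. Qed.

Lemma rank_eq B : indep M B -> (forall I, indep M I -> #|I| <= #|B|) ->
  rank M = #|B|.
Proof.
move=> iB maxB; apply/eqP; rewrite eqn_leq leq_card_rank // andbT.
by rewrite /rank; have [I [iI _ <-]] := rk_basis M (ground M); apply: maxB.
Qed.

(** Trades rank and closure for a basis [B] of [H], the form in which hyperplanes are checked
    below. *)
Lemma hyperplaneI H B : H \subset ground M -> B \subset H -> indep M B ->
    #|B|.+1 = rank M -> (forall I, indep M I -> I \subset H -> #|I| <= #|B|) ->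
    (forall x, x \in ground M :\: H -> indep M (x |: B)) ->
  H \in hyperplanes M.
Proof.
move=> sH sBH iB cB maxB extB.
have rH : rk M H = #|B|.
  apply/eqP; rewrite eqn_leq leq_rk // andbT.
  by have [I [iI sI <-]] := rk_basis M H; apply: maxB.
rewrite inE rH cB eqxx andbT /flat; apply/eqP/setP=> x; rewrite inE.
have [xH|xH] := boolP (x \in H).
  by rewrite (subsetP sH) //= (setUidPr _) ?sub1set ?eqxx.
apply/negP=> /andP[xM /eqP rx].
have xB : x \notin B by apply: contra xH => /(subsetP sBH).
have /leq_rk /(_ (setUS [set x] sBH)) : indep M (x |: B).
  by apply: extB; rewrite inE xH.
by rewrite rx rH cardsU1 xB add1n ltnn.
Qed.

Lemma hyperplaneE H : H \in hyperplanes M -> exists B,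
  [/\ H \subset ground M, B \subset H & indep M B] /\
  [/\ #|B|.+1 = rank M, forall I, indep M I -> I \subset H -> #|I| <= #|B|
    & forall x, x \in ground M :\: H -> indep M (x |: B)].
Proof.
rewrite inE => /andP[/eqP fH /eqP rH].
have [B [iB sB cB]] := rk_basis M H; exists B; split; split=> //.
- by apply/subsetP=> x; rewrite -fH inE => /andP[].
- by rewrite cB.
- by move=> I iI sI; rewrite cB; apply: leq_rk.
move=> x /setDP[xM xH].
have [J [iJ sBJ sJ cJ]] := indep_extend iB (subset_trans sB (subsetUr [set x] H)).
have ltH : rk M H < #|J|.
  rewrite ltn_neqAle -{2}cB subset_leq_card // andbT cJ eq_sym.
  by move: xH; rewrite -{1}fH inE xM.
apply: (indepS _ iJ); rewrite subUset sBJ sub1set andbT.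
apply: contraTT ltH => xJ; rewrite -leqNgt; apply: leq_rk => //.
apply/subsetP=> y yJ; have := subsetP sJ y yJ; rewrite !inE => /orP[/eqP yx|//].
by rewrite -yx yJ in xJ.
Qed.

(** Extend two elements of the minor, together with a basis [B] of [C], to a basis of [M], then drop
    the two. The remaining set [A] serves every other pair as well, so the [m.+1] elements of the
    minor represent distinct hyperplanes through [A]. *)
Lemma no_uniform2_minor m : 0 < m -> corank2_bound m ->
  ~ has_minor M (uniform 2 m.+1).
Proof.
move=> m0 bnd [C [D [sC sD dCD [f bf fE]]]].
set S := ground (delete (contract M C) D) in f bf fE.
have [B sBC cE] := contract_indepP M C.
have cS : #|S| = m.+1.
  have := bij_eq_card bf; rewrite !card_sig.
  rewrite -[X in _ = X]/(#|[pred y : 'I_m.+1 | y \in [set: 'I_m.+1]]|).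
  have -> : #|[pred y : 'I_m.+1 | y \in [set: 'I_m.+1]]| = m.+1.
    by rewrite -[RHS]card_ord; apply: eq_card => y; rewrite !inE.
  by move=> <-; apply: eq_card.
have sSM : S \subset ground M.
  by apply/subsetP=> x; rewrite !inE => /and3P[].
have sSC : S \subset ground M :\: C.
  by apply/subsetP=> x; rewrite !inE => /and3P[_ -> ->].
have iE X : X \subset S -> indep M (X :|: B) = (#|X| <= 2).
  move=> sX; pose X' := [set x : {x | x \in S} | val x \in X].
  have eX : [set val x | x in X'] = X.
    apply/setP=> x; apply/imsetP/idP=> [[y yX ->]|xX].
      by move: yX; rewrite inE.
    by exists (exist _ x (subsetP sX _ xX)); rewrite ?inE.
  have := fE X'; rewrite eX /= /delete_indep /= sX /= cE (subset_trans sX sSC) /=.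
  move=> ->; rewrite /uniform_indep card_imset; last first.
    by apply: inj_comp; [apply: val_inj | apply: bij_inj].
  by rewrite -eX (card_imset _ val_inj).
have dSC : [disjoint S & C] by move: sSC; rewrite subsetD => /andP[].
have dSB : [disjoint S & B] := disjointWr sBC dSC.
have /card_gt1P [z0 [w0 [z0S w0S zw0]]] : 1 < #|S| by rewrite cS ltnS.
have sP z w : z \in S -> w \in S -> [set z; w] \subset S.
  by move=> zS wS; rewrite subUset !sub1set zS.
have iP z w : z \in S -> w \in S -> indep M ([set z; w] :|: B).
  by move=> zS wS; rewrite iE ?sP // cards2; case: (z != w).
have [K [iK s0K _ cK]] :=
  indep_extend (iP _ _ z0S w0S) (indep_ground (iP _ _ z0S w0S)).
(* No triple of the minor is independent, so an independent set of [M] that contains [B] and a pair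
   from [S] has no further point of [S]. *)
have only z w J v : z \in S -> w \in S -> z != w -> indep M J ->
    [set z; w] :|: B \subset J -> v \in J -> v \in S -> v \in [set z; w].
  move=> zS wS zw iJ sJ vJ vS; apply: contraT => vzw.
  have : indep M ((v |: [set z; w]) :|: B).
    by apply: (indepS _ iJ); rewrite -setUA subUset sub1set vJ.
  by rewrite iE ?subUset ?sub1set ?vS ?zS ?wS // cardsU1 vzw cards2 zw.
pose A := K :\: [set z0; w0].
have s2K : [set z0; w0] \subset K.
  by apply: subset_trans s0K; apply: subsetUl.
have cA : #|A|.+2 = rank M.
  rewrite /rank -cK /A cardsD (setIidPr s2K) cards2 zw0.
  by have := subset_leq_card s2K; rewrite cards2 zw0 => c2; rewrite -addn2 subnK.
suff : #|S| <= m by rewrite cS ltnn.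
apply: (bnd A) => //.
  rewrite disjoint_subset; apply/subsetP=> v vS; rewrite inE /=.
  apply/negP=> /setDP[vK /negP vn]; apply: vn.
  exact: (only z0 w0 K).
move=> z w zS wS zw.
(* [J] avoids the rest of [S], hence lies in [z |: (w |: A)]; counting forces equality. *)
have [J [iJ szJ sJ cJ]] := indep_extend (iP _ _ zS wS)
  (setUS [set z; w] (subset_trans (subsetUr _ _) s0K)).
suff -> : z |: (w |: A) = J by [].
rewrite setUA; apply/esym/eqP; rewrite eqEcard; apply/andP; split.
  apply/subsetP=> v vJ.
  have [vS|vS] := boolP (v \in S).
    by rewrite in_setU (only z w J).
  have := subsetP sJ v vJ; rewrite !in_setU => /orP[->//|vK].
  rewrite in_setD vK andbT; apply/orP; right; apply: contra vS.
  by apply/subsetP/sP.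
apply: leq_trans (leq_card_setU _ _) _.
rewrite cJ cards2 zw.
apply: leq_trans (_ : #|K| <= _); first by rewrite cK -[rk _ _]/(rank M) -cA.
by apply: leq_rk => //; apply: subsetUr.
Qed.

End CorankTwo.

(** * Matroids of rank at most 4 given by lines and planes *)

Section LinesPlanes.
Variables (T : finType) (lines planes : {set {set T}}).
Implicit Types (H I J L X : {set T}).

(* [lines] and [planes] need only contain enough of the lines and planes of the
   rank-4 matroid to detect its dependent triples and quadruples. *)
Definition lp_indep : pred {set T} := fun X =>
  [&& #|X| <= 4, [forall L in lines, #|X :&: L| <= 2]
    & [forall H in planes, #|X :&: H| <= 3]].

Lemma lp_indepP X :
  reflect [/\ #|X| <= 4, forall L, L \in lines -> #|X :&: L| <= 2
            & forall H, H \in planes -> #|X :&: H| <= 3]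
          (lp_indep X).
Proof.
rewrite /lp_indep; apply: (iffP and3P) => -[c4 hL hP]; split=> //.
- by move=> L Ll; move/forall_inP: hL; apply.
- by move=> L Ll; move/forall_inP: hP; apply.
- by apply/forall_inP.
- by apply/forall_inP.
Qed.

Hypothesis lineI : forall L L', L \in lines -> L' \in lines ->
  1 < #|L :&: L'| -> L = L'.
Hypothesis planeI : forall H H' I, H \in planes -> H' \in planes ->
  lp_indep I -> #|I| = 3 -> I \subset H -> I \subset H' -> H = H'.
Hypothesis line_point : forall L x, L \in lines ->
  exists2 H, H \in planes & x |: L \subset H.

Lemma lp_ground I : lp_indep I -> I \subset [set: T].
Proof. by rewrite subsetT. Qed.

Lemma lp_indep0 : lp_indep set0.
Proof. by apply/lp_indepP; split=> [|L _|H _]; rewrite ?set0I cards0. Qed.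

Lemma lp_indepS I J : I \subset J -> lp_indep J -> lp_indep I.
Proof.
move=> sIJ /lp_indepP[c4 hL hP]; apply/lp_indepP.
by split=> [|L Ll|H Hp]; [apply: leq_trans c4 | apply: leq_trans (hL L Ll)
  | apply: leq_trans (hP H Hp)]; rewrite subset_leq_card ?setSI.
Qed.

Lemma lp_indep_small X : #|X| <= 2 -> lp_indep X.
Proof.
move=> c2; apply/lp_indepP; split=> [|L _|H _].
- exact: leq_trans c2 _.
- by apply: leq_trans c2; rewrite subset_leq_card ?subsetIl.
by apply: (@leq_trans 2) => //; apply: leq_trans c2; rewrite subset_leq_card ?subsetIl.
Qed.

Lemma line_of X : #|X| = 3 -> ~~ lp_indep X ->
  exists2 L, L \in lines & X \subset L.
Proof.
move=> c3 nX.
suff /exists_inP[L Ll cL] : [exists L in lines, 2 < #|X :&: L|].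
  by exists L => //; apply/setIidPl/eqP; rewrite eqEcard subsetIl c3.
apply: contraR nX; rewrite negb_exists_in => /forall_inP hL.
apply/lp_indepP; split=> [|L Ll|H _]; first by rewrite c3.
  by rewrite leqNgt hL.
by rewrite -c3 subset_leq_card ?subsetIl.
Qed.

(** The dependence may come from a line through [x] and two points of [I]; [line_point] then gives a
    plane through that line and the third point. *)
Lemma plane_of I x : lp_indep I -> #|I| = 3 -> x \notin I ->
  ~~ lp_indep (x |: I) -> exists2 H, H \in planes & x |: I \subset H.
Proof.
move=> iI c3 xI nX; have c4 : #|x |: I| = 4 by rewrite cardsU1 xI c3.
have [/exists_inP[L Ll cL]|noL] := boolP [exists L in lines, 2 < #|(x |: I) :&: L|].
  case/lp_indepP: iI => _ /(_ L Ll) cIL _.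
  have eL : (x |: I) :&: L = x |: (I :&: L).
    rewrite setIUl; congr (_ :|: _); apply/setIidPl; rewrite sub1set.
    apply: contraTT cL => xL; rewrite -leqNgt setIUl.
    by rewrite (_ : [set x] :&: L = set0) ?set0U //; apply/disjoint_setI0; rewrite disjoints1.
  have cIL2 : #|I :&: L| = 2.
    by move: cL cIL; rewrite eL cardsU1 !inE (negPf xI) /=; lia.
  have /card_gt0P[c] : 0 < #|I :\: L| by have := cardsID L I; lia.
  rewrite inE => /andP[cL' cI].
  have [H Hp sH] := line_point c Ll; exists H => //.
  have eI : c |: (I :&: L) = I.
    apply/eqP; rewrite eqEcard subUset sub1set cI subsetIl cardsU1 !inE.
    by rewrite (negPf cL') andbF cIL2 c3.
  have xL : x \in L.
    by have : x \in (x |: I) :&: L by [rewrite eL setU11]; rewrite inE => /andP[].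
  move: sH; rewrite subUset sub1set => /andP[cH sLH].
  rewrite subUset sub1set (subsetP sLH) //= -eI subUset sub1set cH.
  exact: subset_trans (subsetIr _ _) sLH.
have /exists_inP[H Hp cH] : [exists H in planes, 3 < #|(x |: I) :&: H|].
  apply: contraR nX; rewrite negb_exists_in => /forall_inP hP.
  apply/lp_indepP; split=> [|L Ll|H Hh]; first by rewrite c4.
    by move: noL; rewrite negb_exists_in => /forall_inP/(_ L Ll); rewrite -leqNgt.
  by rewrite leqNgt hP.
by exists H => //; apply/setIidPl/eqP; rewrite eqEcard subsetIl c4.
Qed.

(** If nothing in [J] extends [I], then [#|I|] is 2 or 3 and each point of [J] shares a line,
    respectively a plane, with [I]. By [lineI] or [planeI] it is the same one throughout, and it
    holds too many points of [J]. *)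
Lemma lp_aug I J : lp_indep I -> lp_indep J -> #|I| < #|J| ->
  exists2 x, x \in J :\: I & lp_indep (x |: I).
Proof.
move=> iI iJ ltIJ; apply/exists_inP; apply: contraT.
rewrite negb_exists_in => /forall_inP noX.
have [x0 x0J x0I] : exists2 x, x \in J & x \notin I.
  by apply/subsetPn; apply: contraL ltIJ => /subset_leq_card; rewrite -leqNgt.
have cx x : x \in J :\: I -> #|x |: I| = #|I|.+1.
  by case/setDP=> _ xI; rewrite cardsU1 xI.
have x0JI : x0 \in J :\: I by rewrite inE x0I.
have cJ : #|J| <= 4 by case/lp_indepP: iJ.
have : 2 <= #|I| <= 3.
  rewrite -ltnS -[_ <= 3]ltnS (leq_trans ltIJ cJ) andbT.
  rewrite ltnNge; apply: contra (noX _ x0JI) => c1.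
  by apply: lp_indep_small; rewrite cx.
case/andP; rewrite leq_eqVlt => /orP[/eqP c2 _|c3 c3'].
  have c3 x : x \in J :\: I -> #|x |: I| = 3 by move/cx; rewrite -c2.
  have [L Ll sL] := line_of (c3 _ x0JI) (noX _ x0JI).
  have sIL : I \subset L by apply: subset_trans sL; apply: subsetUr.
  suff sJL : J \subset L.
    case/lp_indepP: iJ => _ /(_ L Ll); rewrite (setIidPl sJL) => cJ2 _.
    by rewrite -c2 in ltIJ; lia.
  apply/subsetP=> x xJ; have [/(subsetP sIL)//|xI] := boolP (x \in I).
  have xJI : x \in J :\: I by rewrite inE xI.
  have [L' Ll' sL'] := line_of (c3 _ xJI) (noX _ xJI).
  rewrite (@lineI L L') //; first by rewrite (subsetP sL') ?setU11.
  rewrite c2 subset_leq_card // subsetI sIL.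
  by apply: subset_trans sL'; apply: subsetUr.
have {c3 c3'} c3 : #|I| = 3 by apply/eqP; rewrite eqn_leq c3 c3'.
have [H Hp sH] := plane_of iI c3 x0I (noX _ x0JI).
have sIH : I \subset H by apply: subset_trans sH; apply: subsetUr.
suff sJH : J \subset H.
  by case/lp_indepP: iJ => _ _ /(_ H Hp); rewrite (setIidPl sJH); rewrite c3 in ltIJ; lia.
apply/subsetP=> x xJ; have [/(subsetP sIH)//|xI] := boolP (x \in I).
have xJI : x \in J :\: I by rewrite inE xI.
have [H' Hp' sH'] := plane_of iI c3 xI (noX _ xJI).
rewrite (@planeI H H' I) //; first by rewrite (subsetP sH') ?setU11.
by apply: subset_trans sH'; apply: subsetUr.
Qed.

Definition lp_matroid : matroid T :=
  Matroid lp_ground lp_indep0 lp_indepS lp_aug.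

End LinesPlanes.

Lemma disjointsU1 (T : finType) (x : T) (A B : {set T}) :
  [disjoint x |: A & B] = (x \notin B) && [disjoint A & B].
Proof. by rewrite !disjoints_subset subUset sub1set inE. Qed.

(** * Parallel connection with a line *)

Section Cone.
Variables (T : finType) (M : matroid T) (p : T) (l : nat).
Implicit Types (X I J : {set T + 'I_l}).

Definition lpart X : {set T} := [set a | inl a \in X].
Definition rpart X : {set 'I_l} := [set y | inr y \in X].

Lemma card_parts X : #|X| = #|lpart X| + #|rpart X|.
Proof.
rewrite -!sum1_card big_sumType /=.
by congr (_ + _); apply: eq_bigl => x; rewrite inE.
Qed.

Lemma lpartU1l a X : lpart (inl a |: X) = a |: lpart X.
Proof. by apply/setP=> b; rewrite !inE. Qed.

Lemma rpartU1l a X : rpart (inl a |: X) = rpart X.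
Proof. by apply/setP=> b; rewrite !inE. Qed.

Lemma lpartU1r y X : lpart (inr y |: X) = lpart X.
Proof. by apply/setP=> b; rewrite !inE. Qed.

Lemma rpartU1r y X : rpart (inr y |: X) = y |: rpart X.
Proof. by apply/setP=> b; rewrite !inE. Qed.

Definition partsE := (lpartU1l, rpartU1l, lpartU1r, rpartU1r).

Lemma lpartS I J : I \subset J -> lpart I \subset lpart J.
Proof. by move=> sIJ; apply/subsetP=> a; rewrite !inE; apply: (subsetP sIJ). Qed.

Lemma rpartS I J : I \subset J -> rpart I \subset rpart J.
Proof. by move=> sIJ; apply/subsetP=> a; rewrite !inE; apply: (subsetP sIJ). Qed.

(* [cone] is the parallel connection of [M] at [p] with a line whose points
   other than [p] are the [inr y]: two of these span [p]. *)
Definition cone_ground : {set T + 'I_l} :=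
  [set x | if x is inl a then a \in ground M else true].

(** Two new points act like [p] and one new point. That [p] is not in [lpart X] is required
    separately, because [p |: lpart X] would otherwise collapse to [lpart X]. *)
Definition cone_indep : pred {set T + 'I_l} := fun X =>
  [&& #|rpart X| <= 2, indep M (lpart X)
    & (#|rpart X| == 2) ==> (p \notin lpart X) && indep M (p |: lpart X)].

Lemma cone_indep_ground I : cone_indep I -> I \subset cone_ground.
Proof.
case/and3P=> _ /indep_ground/subsetP sI _; apply/subsetP=> -[a|y] xI; rewrite inE //.
by apply: sI; rewrite inE.
Qed.

Lemma cone_indep0 : cone_indep set0.
Proof.
have -> : cone_indep set0 = indep M set0.
  rewrite /cone_indep (_ : rpart set0 = set0) ?cards0 ?andbT /=.
    by congr indep; apply/setP=> a; rewrite !inE.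
  by apply/setP=> a; rewrite !inE.
exact: indep0.
Qed.

Lemma cone_indepS I J : I \subset J -> cone_indep J -> cone_indep I.
Proof.
move=> sIJ /and3P[c2 iJ /implyP hp].
have c := subset_leq_card (rpartS sIJ).
rewrite /cone_indep (leq_trans c c2) (indepS (lpartS sIJ) iJ) /=.
apply/implyP=> /eqP cI; have /andP[pJ iJp] : (p \notin lpart J) && indep M (p |: lpart J).
  by apply: hp; rewrite eqn_leq c2 -cI.
by rewrite (contra _ pJ) ?(indepS _ iJp) ?setUS ?lpartS //; apply/subsetP/lpartS.
Qed.

Lemma cone_indep_le1 X : #|rpart X| <= 1 -> cone_indep X = indep M (lpart X).
Proof.
by move=> c1; rewrite /cone_indep (leq_trans c1) //= (ltn_eqF (n := 2)) // andbT.
Qed.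

Lemma cone_indep_eq2 X : #|rpart X| = 2 ->
  cone_indep X = (p \notin lpart X) && indep M (p |: lpart X).
Proof.
move=> c2; rewrite /cone_indep c2 /= andbC -andbA; congr (_ && _).
case: (boolP (indep M (p |: _))) => //= /indepS -> //; exact: subsetUr.
Qed.

(** If [I] has two new points, [p |: lpart I] is extended in [M]. Otherwise an old point is added
    when [J] has more old points than [I], and a new point is tried when it does not. *)
Lemma cone_aug I J : cone_indep I -> cone_indep J -> #|I| < #|J| ->
  exists2 x, x \in J :\: I & cone_indep (x |: I).
Proof.
move=> iI iJ; rewrite !card_parts => ltIJ.
have [cI i1I _] := and3P iI; have [cJ i1J _] := and3P iJ.
have addr : #|rpart I| < #|rpart J| -> exists2 y, inr y \in J :\: I &
    #|rpart (inr y |: I)| = #|rpart I|.+1.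
  move=> lt; have /subsetPn[y yJ yI] : ~~ (rpart J \subset rpart I).
    by apply: contraL lt => /subset_leq_card; rewrite -leqNgt.
  exists y; first by move: yJ yI; rewrite !inE => -> ->.
  by rewrite partsE cardsU1 yI.
have [c1|c2] := leqP #|rpart I| 1; last first.
  have {cI c2} c2 : #|rpart I| = 2 by apply/eqP; rewrite eqn_leq cI.
  move: iI; rewrite cone_indep_eq2 // => /andP[pI ipI].
  suff [K iK [sK ltK]] : exists2 K, indep M K &
      K \subset p |: lpart J /\ #|p |: lpart I| < #|K|.
    have [x /setDP[xK]] := indep_aug ipI iK ltK.
    rewrite in_setU1 negb_or => /andP[xp xI] ix.
    have xJ : x \in lpart J.
      by have := subsetP sK _ xK; rewrite in_setU1 (negPf xp).
    exists (inl x); first by move: xJ xI; rewrite !inE => -> ->.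
    by rewrite cone_indep_eq2 partsE // setUCA ix in_setU1 eq_sym negb_or xp pI.
  rewrite cardsU1 pI; case: (ltngtP #|rpart J| 2) cJ => // cJ2 _.
    by exists (lpart J) => //; split; [apply: subsetUr | lia].
  move: iJ; rewrite cone_indep_eq2 // => /andP[pJ ipJ].
  exists (p |: lpart J) => //; split=> //; rewrite cardsU1 pJ; lia.
have [lt1|ge1] := ltnP #|lpart I| #|lpart J|.
  have [x /setDP[xJ xI] ix] := indep_aug i1I i1J lt1.
  exists (inl x); first by move: xJ xI; rewrite !inE => -> ->.
  by rewrite cone_indep_le1 partsE.
have [|y yJI cy] := addr; first by lia.
have [c0|c0] := leqP #|rpart I| 0.
  exists (inr y) => //; rewrite cone_indep_le1 ?cy ?partsE //; lia.
have cJ2 : #|rpart J| = 2 by lia.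
move: iJ; rewrite cone_indep_eq2 // => /andP[pJ ipJ].
(* Here [I] has one new point, [J] has two, and the left parts have equal size. If [p] extends
   [lpart I], a second new point may be added; otherwise an old point of [J] works. *)
have [|x] := indep_aug i1I ipJ; first by rewrite cardsU1 pJ; lia.
rewrite in_setD in_setU1 => /andP[xI] /orP[/eqP xp|xJ] ix.
  exists (inr y) => //; rewrite cone_indep_eq2; last by rewrite cy; lia.
  by rewrite partsE -xp xI.
exists (inl x); first by move: xJ xI; rewrite !inE => -> ->.
by rewrite cone_indep_le1 partsE.
Qed.

Definition cone : matroid (T + 'I_l)%type :=
  Matroid cone_indep_ground cone_indep0 cone_indepS cone_aug.

Definition inlset (A : {set T}) : {set T + 'I_l} :=
  [set x | if x is inl a then a \in A else false].

Lemma lpart_inlset A : lpart (inlset A) = A.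
Proof. by apply/setP=> a; rewrite !inE. Qed.

Lemma rpart_inlset A : rpart (inlset A) = set0.
Proof. by apply/setP=> a; rewrite !inE. Qed.

Lemma rank_cone : 0 < l -> rank cone = (rank M).+1.
Proof.
move=> l0; have [B [iB _ cB]] := rk_basis M (ground M).
pose y := Ordinal l0.
have rE : rpart (inr y |: inlset B) = [set y].
  by rewrite partsE rpart_inlset setU0.
have cE : #|inr y |: inlset B| = (rank M).+1.
  by rewrite card_parts rE cards1 partsE lpart_inlset cB addn1.
rewrite -cE; apply: rank_eq.
  by rewrite /= cone_indep_le1 ?rE ?cards1 // partsE lpart_inlset.
move=> I /= iI; rewrite cE card_parts.
have [c2 iI1 _] := and3P iI; have := leq_card_rank iI1.
case: (ltngtP #|rpart I| 2) c2 => // [c1 _|c2 _ _]; first by lia.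
move: iI; rewrite cone_indep_eq2 // => /andP[pI /leq_card_rank].
by rewrite cardsU1 pI c2; lia.
Qed.

(** Split by the number of new points in [A]. With none, [#|lpart A|] is one below the rank of [M],
    so [S] has at most one old point besides at most [l] new ones. With one, [S] has at most one new
    point, and [p] can stand for it. With two, [A] spans [p], and the bound applies to
    [p |: lpart A]. With three, [A] is dependent. *)
Lemma corank2_bound_cone : 0 < l -> corank2_bound M l.+1 -> corank2_bound cone l.+1.
Proof.
move=> l0 bM A S; rewrite rank_cone // card_parts => cA dSA iS.
have nA x : x \in S -> x \notin A by move/(disjointFr dSA)=> ->.
have cr : #|rpart S| <= l by rewrite -[X in _ <= X]card_ord max_card.
have dl : [disjoint lpart S & lpart A].
  rewrite disjoint_subset; apply/subsetP=> a; rewrite !inE; exact: nA.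
have lS z w : z \in lpart S -> w \in lpart S -> z != w ->
    cone_indep (inl z |: (inl w |: A)).
  by rewrite !inE => zS wS zw; apply: iS.
have le1 (U : finType) (X : {set U}) : {in X &, forall z w, z = w} -> #|X| <= 1.
  by move=> hX; rewrite leqNgt; apply/negP=> /card_gt1P[z [w [zX wX]]] /eqP; apply; apply: hX.
have cR y : inr y \in S -> #|rpart (inr y |: A)| = #|rpart A|.+1.
  by move=> /nA yA; rewrite partsE cardsU1 inE yA.
have [c2|c2] := ltnP #|rpart A| 3; last first.
  apply: leq_trans (le1 _ S _) _ => // z w zS wS; apply/eqP/contraT=> zw.
  have /and3P[cc _ _] := iS z w zS wS zw.
  have := subset_leq_card (rpartS (subset_trans (subsetUr [set w] A) (subsetUr [set z] (w |: A)))).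
  by lia.
case E : #|rpart A| c2 => [|[|[|]]] // _.
- have cl : #|lpart S| <= 1.
    apply: le1 => z w zS wS; apply/eqP/contraT=> zw.
    have := lS z w zS wS zw; rewrite cone_indep_le1 !partsE ?E //.
    move/leq_card_rank; rewrite !cardsU1 !inE.
    rewrite (negPf zw) (negPf (nA _ _)) 1?(negPf (nA _ _)) //=; last by move: zS; rewrite inE.
      by lia.
    by move: wS; rewrite inE.
  by rewrite card_parts; lia.
- have iz z w : z \in lpart S -> w \in lpart S -> z != w ->
      indep M (z |: (w |: lpart A)).
    by move=> zS wS zw; have := lS z w zS wS zw; rewrite cone_indep_le1 !partsE ?E.
  have r1 : #|rpart S| <= 1.
    apply: le1 => y y' yS y'S; apply/eqP/contraT=> yy.
    have : cone_indep (inr y |: (inr y' |: A)).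
      by apply: iS => //; [move: yS | move: y'S]; rewrite inE.
    case/and3P; rewrite !partsE !cardsU1 E !inE (negPf yy).
    rewrite (negPf (nA _ _)) 1?(negPf (nA _ _)) //; last by move: yS; rewrite inE.
    by move: y'S; rewrite inE.
  have cA' : #|lpart A|.+2 = rank M by lia.
  case: (set_0Vmem (rpart S)) => [r0|[y yS]].
    by rewrite card_parts r0 cards0 addn0; apply: (bM (lpart A)).
  rewrite inE in yS.
  have ip w : w \in lpart S -> (p \notin w |: lpart A) && indep M (p |: (w |: lpart A)).
    rewrite inE => wS; have : cone_indep (inr y |: (inl w |: A)) by apply: iS.
    rewrite cone_indep_eq2 !partsE // cardsU1 E inE.
    by rewrite (negPf (nA _ _)).
  case: (set_0Vmem (lpart S)) => [s0|[w0 w0S]].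
    by rewrite card_parts s0 cards0; lia.
  have pS : p \notin lpart S.
    by apply/negP=> /ip; rewrite setU11.
  apply: (@leq_trans #|p |: lpart S|).
    by rewrite card_parts cardsU1 pS; lia.
  apply: (bM (lpart A)) => //.
    have := ip _ w0S; rewrite in_setU1 negb_or => /andP[/andP[_ pA] _].
    by rewrite disjointsU1 pA dl.
  move=> z w; rewrite !in_setU1 => /orP[/eqP->|zS] /orP[/eqP->|wS] zw.
  + by rewrite eqxx in zw.
  + by case/andP: (ip _ wS).
  + by rewrite setUCA; case/andP: (ip _ zS).
  exact: iz.
have rS0 y : inr y \notin S \/ #|S| <= 1.
  have [yS|] := boolP (inr y \in S); last by left.
  right; apply: le1.
  suff h z : z \in S -> z = inr y by move=> z w /h-> /h->.
  move=> zS; apply/eqP/contraT=> zy.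
  have /and3P[cc _ _] := iS z (inr y) zS yS zy.
  have := subset_leq_card (rpartS (subsetUr [set z] (inr y |: A))).
  by rewrite cR // E => /leq_trans/(_ cc).
have [|c1] := leqP #|S| 1; first by lia.
have r0 : rpart S = set0.
  apply/setP=> y; rewrite !inE; apply/negbTE.
  by case: (rS0 y) => //; rewrite leqNgt c1.
have ip z w : z \in lpart S -> w \in lpart S -> z != w ->
    (p \notin z |: (w |: lpart A)) && indep M (p |: (z |: (w |: lpart A))).
  by move=> zS wS zw; have := lS z w zS wS zw; rewrite cone_indep_eq2 !partsE ?E.
move: c1; rewrite card_parts r0 cards0 addn0 => c1.
have /card_gt1P[z0 [w0 [z0S w0S zw0]]] := c1.
have /andP[pn _] := ip _ _ z0S w0S zw0.
have pS : p \notin lpart S.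
  apply/negP=> pS; have [pz|pz] := eqVneq p z0; first by rewrite pz setU11 in pn.
  by have := ip _ _ pS z0S pz; rewrite setU11.
apply: (bM (p |: lpart A)).
- move: pn; rewrite !in_setU1 !negb_or => /and3P[_ _ pA].
  by rewrite cardsU1 pA; lia.
- by rewrite disjoint_sym disjointsU1 pS disjoint_sym.
move=> z w zS wS zw; case/andP: (ip _ _ zS wS zw) => _.
by rewrite (setUCA [set p] [set z]) (setUCA [set p] [set w]).
Qed.

(** A second new point would span [p] together with [y], and [p] lies outside [H]; hence the set is
    closed. *)
Lemma hyperplane_cone (H : {set T}) (y : 'I_l) :
    p \in ground M -> p \notin H -> H \in hyperplanes M ->
  inr y |: inlset H \in hyperplanes cone.
Proof.
move=> pM pH /hyperplaneE[B [[sH sB iB] [cB maxB extB]]].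
have rE (X : {set T}) : rpart (inr y |: inlset X) = [set y].
  by rewrite partsE rpart_inlset setU0.
have lE (X : {set T}) : lpart (inr y |: inlset X) = X by rewrite partsE lpart_inlset.
have cE (X : {set T}) : #|inr y |: inlset X| = #|X|.+1.
  by rewrite card_parts rE lE cards1 addn1.
have l0 : 0 < l by case: (y) => m /=; apply: leq_ltn_trans.
apply: (@hyperplaneI _ _ _ (inr y |: inlset B)).
- apply/subsetP=> -[a|y']; rewrite !inE //= ; exact: (subsetP sH).
- apply: setUS; apply/subsetP=> -[a|y'] //; rewrite !inE //; exact: (subsetP sB).
- by rewrite /= cone_indep_le1 ?rE ?cards1 // lE.
- by rewrite cE cB rank_cone.
- move=> I iI sI; rewrite cE card_parts.
  have := subset_leq_card (rpartS sI); rewrite rE cards1 => c1.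
  have : #|lpart I| <= #|B|.
    by apply: maxB; [case/and3P: iI | have := lpartS sI; rewrite lE].
  by lia.
move=> [a|y']; rewrite in_setD => /andP[xH xM] /=.
  rewrite cone_indep_le1 ?partsE ?rpart_inlset ?setU0 ?cards1 //.
  rewrite lpart_inlset extB //; move: xH xM; rewrite !inE /= => -> -> //.
have yy : y' != y by move: xH; rewrite !inE negb_or => /andP[].
rewrite cone_indep_eq2 ?partsE ?lpart_inlset.
  by rewrite extB ?inE ?pH // andbT; apply: contra pH => /(subsetP sB).
by rewrite rpart_inlset setU0 cards2 yy.
Qed.

Lemma card_hyperplanes_cone N : p \in ground M ->
  N <= #|[set H in hyperplanes M | p \notin H]| ->
  N * l <= #|[set H in hyperplanes cone | inl p \notin H]|.
Proof.
move=> pM leN; pose h (u : {set T} * 'I_l) := inr u.2 |: inlset u.1.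
pose Q := setX [set H in hyperplanes M | p \notin H] [set: 'I_l].
have hI : injective h.
  move=> [H y] [H' y'] eh; congr pair.
    have := congr1 lpart eh; by rewrite /h !partsE !lpart_inlset.
  have := congr1 rpart eh; rewrite /h !partsE !rpart_inlset !setU0 /=.
  exact: set1_inj.
apply: (@leq_trans #|h @: Q|).
  by rewrite card_imset // cardsX cardsT card_ord leq_mul.
apply/subset_leq_card/subsetP=> _ /imsetP[[H y] + ->].
rewrite in_setX /= => /andP[]; rewrite inE => /andP[hH pH] _.
by rewrite inE hyperplane_cone // /h /= !inE.
Qed.

End Cone.

(** * Interpolation by quadratic polynomials *)

Section Quadratics.
Variables (R : finComUnitRingType) (k : nat) (t : 'I_k -> R).
Hypothesis t_unit : forall i j, i != j -> (t i - t j)%R \is a GRing.unit.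
Implicit Types (q : R * R * R) (i j m : 'I_k).

Definition qv q i : R := (q.1.1 * t i ^+ 2 + q.1.2 * t i + q.2)%R.

Lemma unit_mul0 i j (a : R) : i != j -> ((t i - t j) * a = 0)%R -> a = 0%R.
Proof. by move=> /t_unit u; rewrite -[RHS](mulr0 (t i - t j)%R) => /(mulrI u). Qed.

Lemma qv_inj2 q q' i j : i != j -> q.1.1 = q'.1.1 ->
  qv q i = qv q' i -> qv q j = qv q' j -> q = q'.
Proof.
case: q q' => [[a b] c] [[a' b'] c'] nij /= <- {a'}; rewrite /qv /= => ei ej.
have eb : b = b'.
  apply/eqP; rewrite -subr_eq0; apply/eqP; apply: (unit_mul0 nij).
  transitivity (qv (a, b, c) i - qv (a, b', c') i
    - (qv (a, b, c) j - qv (a, b', c') j))%R; rewrite /qv /=; first by ring.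
  by rewrite ei ej !subrr.
by rewrite eb in ei *; move/addrI: ei => ->.
Qed.

(** [hj] and [hm] are first divided differences of [q - q']; subtracting them leaves
    [(t j - t m) * (a - a')]. *)
Lemma qv_inj3 q q' i j m : i != j -> i != m -> j != m ->
  qv q i = qv q' i -> qv q j = qv q' j -> qv q m = qv q' m -> q = q'.
Proof.
move=> nij nim njm ei ej em.
suff ea : q.1.1 = q'.1.1 by apply: (@qv_inj2 _ _ i j).
apply/eqP; rewrite -subr_eq0; apply/eqP; apply: (unit_mul0 njm).
have diff n : qv q n = qv q' n -> (qv q n - qv q' n = 0)%R by move=> ->; apply: subrr.
move: (diff _ ei) (diff _ ej) (diff _ em); rewrite /qv.
case: q q' {ei ej em diff} => [[a b] c] [[a' b'] c'] /= di dj dm.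
have hj : ((a - a') * (t i + t j) + (b - b') = 0)%R.
  apply: (unit_mul0 nij); rewrite -[RHS](subrr 0%R) -{1}di -dj; ring.
have hm : ((a - a') * (t i + t m) + (b - b') = 0)%R.
  apply: (unit_mul0 nim); rewrite -[RHS](subrr 0%R) -{1}di -dm; ring.
by rewrite -[RHS](subrr 0%R) -{1}hj -hm; ring.
Qed.

(** Evaluation at three nodes is an injective self-map of the finite set [R * R * R]. *)
Lemma qv_surj i j m y y' u : i != j -> i != m -> j != m ->
  exists q, [/\ qv q i = y, qv q j = y' & qv q m = u].
Proof.
move=> nij nim njm; pose f q : R * R * R := (qv q i, qv q j, qv q m).
have fI : injective f by move=> q q' [ei ej em]; apply: (qv_inj3 nij nim njm).
have [g _ gK] := injF_bij fI; exists (g (y, y', u)).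
by have [-> -> ->] := gK (y, y', u).
Qed.

(** * Columns, graphs and planes *)

Implicit Types (o : option ('I_k * R)) (u : {set 'I_k}).

Definition graph q u : {set option ('I_k * R)} := [set Some (i, qv q i) | i in u].

Definition column i : {set option ('I_k * R)} :=
  [set o | if o is Some z then z.1 == i else true].

(* [None] is the common point of all the columns. *)
Definition columns : {set {set option ('I_k * R)}} := [set column i | i : 'I_k].

Definition planes : {set {set option ('I_k * R)}} :=
  [set column z.1 :|: column z.2 | z in [set z : 'I_k * 'I_k | z.1 != z.2]]
  :|: [set graph q setT | q in [set q : R * R * R | q.1.1 != 0%R]].

Lemma in_graph q u i y : (Some (i, y) \in graph q u) = (i \in u) && (y == qv q i).
Proof.
apply/imsetP/andP=> [[j ju [-> ->]]|[iu /eqP->]]; first by rewrite ju eqxx.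
by exists i.
Qed.

Lemma None_graph q u : None \notin graph q u.
Proof. by apply/imsetP=> -[]. Qed.

Lemma in_column i o : (o \in column i) = if o is Some z then z.1 == i else true.
Proof. by rewrite inE. Qed.

Lemma card_graph q u : #|graph q u| = #|u|.
Proof. by rewrite card_imset // => i j []. Qed.

Lemma graphS q u u' : u \subset u' -> graph q u \subset graph q u'.
Proof. exact: imsetS. Qed.

Lemma graph_inj q q' u u' : 2 < #|graph q u :&: graph q' u'| -> q = q'.
Proof.
case/card_gt2P=> x [y [z [[]]]]; case: x => [[i x]|] /setIP[hx hx']; last first.
  by rewrite (negPf (None_graph _ _)) in hx.
case: y => [[j y]|] /setIP[hy hy']; last first.
  by rewrite (negPf (None_graph _ _)) in hy.
case: z => [[m z]|] /setIP[hz hz'] [xy yz zx]; last first.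
  by rewrite (negPf (None_graph _ _)) in hz.
move: hx hx' hy hy' hz hz'; rewrite !in_graph.
move=> /andP[_ /eqP ex] /andP[_ /eqP ex'] /andP[_ /eqP ey] /andP[_ /eqP ey'].
move=> /andP[_ /eqP ez] /andP[_ /eqP ez'].
apply: (@qv_inj3 _ _ i j m); rewrite -?ex -?ey -?ez //.
- by apply: contraNneq xy => ij; rewrite ex ey ij.
- by apply: contraNneq zx => im; rewrite ex ez im.
- by apply: contraNneq yz => jm; rewrite ey ez jm.
Qed.

Lemma card_graph_column q u i : #|graph q u :&: column i| <= 1.
Proof.
rewrite leqNgt; apply/negP=> /card_gt1P[x [y [/setIP[xg xc] /setIP[yg yc]]]].
case: x xg xc => [[j x]|]; last by rewrite (negPf (None_graph _ _)).
case: y yg yc => [[m y]|]; last by rewrite (negPf (None_graph _ _)).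
rewrite !in_graph !in_column /= => /andP[_ /eqP->] /eqP-> /andP[_ /eqP->] /eqP->.
by rewrite eqxx.
Qed.

Lemma card_column2 i j : i != j -> #|column i :&: column j| <= 1.
Proof.
move=> nij; rewrite -(cards1 (None : option ('I_k * R))) subset_leq_card //.
apply/subsetP=> -[z|]; rewrite !inE // => /andP[/eqP->].
by rewrite (negPf nij).
Qed.

Lemma card_graph_column2 q u i j : #|graph q u :&: (column i :|: column j)| <= 2.
Proof.
rewrite setIUr (leq_trans (leq_card_setU _ _)) // -[2]/(1 + 1).
by rewrite leq_add ?card_graph_column.
Qed.

Lemma in_columns i : column i \in columns.
Proof. exact: imset_f. Qed.

Lemma columns_plane i j : i != j -> column i :|: column j \in planes.
Proof. by move=> nij; rewrite inE; apply/orP; left; apply/imsetP; exists (i, j); rewrite ?inE. Qed.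

Lemma graph_plane q : q.1.1 != 0%R -> graph q setT \in planes.
Proof. by move=> q0; rewrite inE; apply/orP; right; apply/imsetP; exists q; rewrite ?inE. Qed.

Variant planes_spec : {set option ('I_k * R)} -> Prop :=
  | PlaneColumns i j of i != j : planes_spec (column i :|: column j)
  | PlaneGraph q of q.1.1 != 0%R : planes_spec (graph q setT).

Lemma planesP H : H \in planes -> planes_spec H.
Proof.
case/setUP=> /imsetP[x]; rewrite inE => xP ->; first exact: PlaneColumns.
exact: PlaneGraph.
Qed.

Lemma columnI L L' : L \in columns -> L' \in columns -> 1 < #|L :&: L'| -> L = L'.
Proof.
case/imsetP=> i _ -> /imsetP[j _ ->]; have [->//|nij] := eqVneq i j.
by rewrite ltnNge card_column2.
Qed.

(** An independent triple lies in no column. Inside a union of two columns it has a point other than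
    [None] in each, which recovers the pair. A graph meets such a union in at most two points, and
    three common points identify two graphs. *)
Lemma planes_inj H H' I : H \in planes -> H' \in planes ->
  lp_indep columns planes I -> #|I| = 3 -> I \subset H -> I \subset H' -> H = H'.
Proof.
move=> HP H'P /lp_indepP[_ iC _] c3 sH sH'.
have c3I : 2 < #|H :&: H'| by rewrite -c3 subset_leq_card // subsetI sH.
have noC i : ~ I \subset column i.
  by move=> /setIidPl sI; have := iC _ (in_columns i); rewrite sI c3.
case/planesP: HP sH c3I => [i j nij|q _]; case/planesP: H'P sH' => [i' j' nij'|q' _].
- move=> sH' sH _.
  (* [I] leaves the other column [d], so it has a point whose only column is [c]. *)
  have sub (a b : 'I_k) : a != b -> I \subset column a :|: column b ->
      forall c, (c == a) || (c == b) -> exists2 z, z \in I & forall d, (z \in column d) = (d == c).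
    move=> nab sab c cab.
    pose d := if c == a then b else a.
    have /subsetPn[[z|] zI zd] : ~~ (I \subset column d) by apply/negP/noC.
      exists (Some z) => // e; have := subsetP sab _ zI.
      move: zd; rewrite !inE /d; case/orP: cab => /eqP->; rewrite ?eqxx.
        by move=> /negPf-> /[!orbF] /eqP->; rewrite eq_sym.
      by rewrite (eq_sym b) (negPf nab) => /negPf-> /= /eqP->; rewrite eq_sym.
    by rewrite inE in zd.
  have inab (a b : 'I_k) : I \subset column a :|: column b ->
      forall z c, z \in I -> (forall d, (z \in column d) = (d == c)) -> (c == a) || (c == b).
    move=> sab z c zI zc; have := subsetP sab _ zI.
    by rewrite in_setU !zc ![_ == c]eq_sym.
  have inc (a b a' b' : 'I_k) : a != b -> I \subset column a :|: column b ->
     I \subset column a' :|: column b' -> [set a; b] \subset [set a'; b'].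
    move=> nab sab sab'; apply/subsetP=> c; rewrite !inE => /(sub _ _ nab sab)[z zI zc].
    exact: (inab _ _ sab' z).
  have e2 : [set i; j] = [set i'; j'].
    by apply/eqP; rewrite eqEsubset !inc.
  have cE (a b : 'I_k) : column a :|: column b = \bigcup_(c in [set a; b]) column c.
    by rewrite bigcup_setU !big_set1.
  by rewrite !cE e2.
- by move=> _ _; rewrite setIC ltnNge card_graph_column2.
- by move=> _ _; rewrite ltnNge card_graph_column2.
by move=> _ _ /graph_inj->.
Qed.

(** * The rank-4 matroid: its hyperplanes and its corank-2 bound *)

Hypothesis k3 : 2 < k.

Lemma other_index i : exists j, j != i.
Proof.
have /card_gt0P[j] : 0 < #|[set~ i]|.
  by rewrite cardsC1 card_ord -subn1 subn_gt0 ltnW.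
by rewrite !inE; exists j.
Qed.

Lemma column_point L o : L \in columns ->
  exists2 H, H \in planes & o |: L \subset H.
Proof.
case/imsetP=> i _ ->.
have [j nji oj] : exists2 j, j != i & o \in column i :|: column j.
  have [j nji] := other_index i.
  case: o => [[m y]|]; last by exists j; rewrite ?inE.
  have [->|nmi] := eqVneq m i; first by exists j; rewrite ?inE ?eqxx.
  by exists m; rewrite ?inE ?eqxx ?orbT.
exists (column i :|: column j); first by rewrite columns_plane // eq_sym.
by rewrite subUset sub1set oj subsetUl.
Qed.

Definition quadratic_matroid : matroid (option ('I_k * R)) :=
  lp_matroid columnI planes_inj column_point.

(* The closure of [graph q u] when [u] has three elements. *)
Definition graph_span q : {set 'I_k} -> {set option ('I_k * R)} := fun u =>
  graph q (if q.1.1 == 0%R then u else setT).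

(** One column meets the graph in at most one point and two columns in at most two, which leaves
    room for [o]. A quadratic graph through all four points would be that of [q], and then [o] would
    lie in the span. *)
Lemma graph_indep q u o : #|u| = 3 -> o \notin graph_span q u ->
  indep quadratic_matroid (o |: graph q u).
Proof.
move=> u3 oq; have cardU H : #|(o |: graph q u) :&: H| <= #|graph q u :&: H|.+1.
  rewrite setIUl (leq_trans (leq_card_setU _ _)) // -add1n leq_add2r.
  by rewrite -(cards1 o) subset_leq_card ?subsetIl.
apply/lp_indepP; split=> [|L /imsetP[i _ ->]|H /planesP[i j _|q' q'0]].
- by rewrite cardsU1 card_graph u3; case: (o \notin _).
- by rewrite (leq_trans (cardU _)) ?ltnS ?card_graph_column.
- by rewrite (leq_trans (cardU _)) ?ltnS ?card_graph_column2.
have ou : o \notin graph q u.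
  by apply: contra oq; apply/subsetP; rewrite /graph_span; case: ifP => // _; apply/graphS/subsetT.
rewrite leqNgt; apply/negP=> c4.
have sH : o |: graph q u \subset graph q' setT.
  apply/setIidPl/eqP; rewrite eqEcard subsetIl (leq_trans _ c4) //.
  by rewrite cardsU1 ou card_graph u3.
have eq : q = q'.
  apply: (@graph_inj q q' u setT); rewrite (setIidPl _) ?card_graph ?u3 //.
  by apply: subset_trans sH; apply: subsetUr.
move: sH; rewrite -eq subUset sub1set => /andP[oH _].
by move: oq; rewrite /graph_span eq (negPf q'0) -eq oH.
Qed.

Lemma rank_quadratic_matroid : rank quadratic_matroid = 4.
Proof.
pose u : {set 'I_k} := [set i : 'I_k | i < 3].
have u3 : #|u| = 3.
  have le3 : 3 <= k by [].
  have -> : u = [set widen_ord le3 i | i : 'I_3].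
    apply/setP=> i; rewrite inE; apply/idP/imsetP=> [i3|[j _ ->]]; last exact: (ltn_ord j).
    by exists (Ordinal i3) => //; apply: val_inj.
  by rewrite card_imset ?card_ord // => a b /(congr1 val) /= /val_inj.
pose q : R * R * R := (0, 0, 0)%R.
have iB : indep quadratic_matroid (None |: graph q u) by apply: graph_indep; rewrite ?None_graph.
have cB : #|None |: graph q u| = 4 by rewrite cardsU1 None_graph card_graph u3.
by rewrite -cB; apply: rank_eq => // I /lp_indepP[]; rewrite cB.
Qed.

(** [u'] covers both cases at once: the triple itself when the leading coefficient is zero, the
    whole graph otherwise. *)
Lemma graph_hyperplane q u u' : #|u| = 3 -> u \subset u' ->
    graph q u' = graph_span q u -> graph q u' \in hyperplanes quadratic_matroid.
Proof.
move=> u3 su' eu'; apply: (@hyperplaneI _ _ _ (graph q u)).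
- exact: subsetT.
- exact: graphS.
- apply: (@indepS _ _ _ (None |: graph q u)); first exact: subsetUr.
  by apply: graph_indep; rewrite // /graph_span None_graph.
- by rewrite card_graph u3 rank_quadratic_matroid.
- move=> I /lp_indepP[_ _ hI]; rewrite eu' /graph_span; case: eqP => [_|/eqP q0] sI.
    exact: subset_leq_card.
  by have := hI _ (graph_plane q0); rewrite (setIidPl sI) card_graph u3.
by move=> o; rewrite eu' => /setDP[_ oq]; apply: graph_indep.
Qed.

(** [Q0] indexes the whole graphs with nonzero leading coefficient, [Q1] the triples on affine
    graphs. Each such set has at least three points and so determines its polynomial and its index
    set. *)
Lemma card_hyperplanes_quadratic_matroid :
  #|R| ^ 2 * (#|R|.-1 + 'C(k, 3)) <=
  #|[set H in hyperplanes quadratic_matroid | None \notin H]|.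
Proof.
pose Q0 := setX (setX (setX [set~ 0%R : R] [set: R]) [set: R]) [set [set: 'I_k]].
pose Q1 := setX (setX (setX [set 0%R : R] [set: R]) [set: R])
                [set u : {set 'I_k} | #|u| == 3].
have dQ : [disjoint Q0 & Q1].
  rewrite disjoint_subset; apply/subsetP=> -[[[a b] c] u]; rewrite !inE /=.
  by move=> /andP[/andP[/andP[/negPf->]]].
have cQ : #|Q0 :|: Q1| = #|R| ^ 2 * (#|R|.-1 + 'C(k, 3)).
  rewrite cardsU (disjoint_setI0 dQ) cards0 subn0 !cardsX cardsC1 !cards1 !cardsT.
  by rewrite card_draws card_ord; ring.
have Q3 q u : (q, u) \in Q0 :|: Q1 -> 2 < #|u|.
  case: q => [[a b] c]; rewrite !inE /=.
  by case/orP=> /andP[_ /eqP->] //; rewrite cardsT card_ord.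
pose g (z : (R * R * R) * {set 'I_k}) := graph z.1 z.2.
have gI : {in Q0 :|: Q1 &, injective g}.
  move=> [q u] [q' u'] zQ z'Q; rewrite /g /= => eg.
  have eq : q = q'.
    by apply: (@graph_inj q q' u u'); rewrite -eg setIid card_graph; apply: Q3 zQ.
  congr pair => //; apply/setP=> i.
  by have := congr1 (fun X : {set option ('I_k * R)} => Some (i, qv q i) \in X) eg;
    rewrite !in_graph eq eqxx !andbT.
rewrite -cQ -(card_in_imset gI); apply/subset_leq_card/subsetP=> _ /imsetP[[q u] zQ ->].
rewrite inE None_graph andbT /g /=.
have [[a0 ->]|[a0 u3]] : (q.1.1 != 0%R /\ u = setT) \/ (q.1.1 = 0%R /\ #|u| = 3).
- case: q zQ => [[a b] c]; rewrite !inE /=.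
  by case/orP=> /andP[/andP[/andP[/eqP a0 _] _] /eqP ?]; [left; split=> //; apply/eqP | right].
- have /card_gt0P[u'] : 0 < #|[set u' : {set 'I_k} | #|u'| == 3]|.
    by rewrite card_draws card_ord bin_gt0.
  rewrite inE => /eqP u3; apply: (@graph_hyperplane _ u'); rewrite ?subsetT //.
  by rewrite /graph_span (negPf a0).
by apply: (@graph_hyperplane _ u) => //; rewrite /graph_span a0 eqxx.
Qed.

(** If one column contains the pair [A], then [S] has at most one point per column. Otherwise [S]
    has at most one point in the two columns of the pair, and [phi] injects the other points into
    [#|R|.-1] quadratic and [k - 2] affine labels. *)
Lemma corank2_bound_quadratic_matroid : 1 < #|R| -> corank2_bound quadratic_matroid (#|R| + k - 2).
Proof.
move=> s1 A S; rewrite rank_quadratic_matroid => -[/eqP/cards2P[a [b [nab ->]]]] dS iS.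
have nS z : z \in S -> (z != a) && (z != b).
  by move/(disjointFr dS); rewrite !inE => /negbT; rewrite negb_or.
have c4 z w : z \in S -> w \in S -> z != w -> #|z |: (w |: [set a; b])| = 4.
  move=> zS wS zw; rewrite !cardsU1 cards1 !inE (negPf zw) (negPf nab).
  by have /andP[/negPf-> /negPf->] := nS z zS; have /andP[/negPf-> /negPf->] := nS w wS.
have noP z w H : z \in S -> w \in S -> z != w -> H \in planes ->
    z \in H -> w \in H -> a \in H -> b \in H -> False.
  move=> zS wS zw HP zH wH aH bH.
  have /lp_indepP[_ _ /(_ H HP)] := iS z w zS wS zw.
  rewrite (setIidPl _) ?c4 //; apply/subsetP=> x.
  by rewrite !inE => /or4P[] /eqP->.
case: (pickP (fun i => (a \in column i) && (b \in column i))) => [i /andP[ai bi]|noi].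
  have [j0 nji] := other_index i.
  pose col o : 'I_k := if o is Some z then z.1 else i.
  have colP o : o \in column i :|: column (col o) by case: o => [z|]; rewrite !inE ?eqxx ?orbT.
  have colI : {in S &, injective col}.
    move=> z w zS wS ezw; apply/eqP; apply: contraT => zw; exfalso.
    pose j := if col z == i then j0 else col z.
    have nij : i != j.
      by rewrite /j; case: ifP => [_|/negbT]; rewrite eq_sym.
    have colj o : col o = col z -> o \in column i :|: column j.
      move=> eo; rewrite /j; case: ifP => [/eqP ei|_]; last by rewrite -eo.
      by have := colP o; rewrite eo ei setUid in_setU => ->.
    apply: (noP z w _ zS wS zw (columns_plane nij)).
    - exact: colj.
    - by apply: colj; rewrite ezw.
    - by rewrite in_setU ai.
    by rewrite in_setU bi.
  (* The bound [k] is enough because [#|R|] is at least 2. *)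
  rewrite -(card_in_imset colI); apply: (@leq_trans k); last by lia.
  by rewrite -[X in _ <= X]card_ord max_card.
have [[i y] [[j y'] [ea eb]]] : exists x x', a = Some x /\ b = Some x'.
  case: a b noi {nab dS iS nS c4 noP} => [x|] [x'|] noi; first by exists x, x'.
  - by have := noi x.1; rewrite !inE eqxx.
  - by have := noi x'.1; rewrite !inE eqxx.
  by have := noi (Ordinal (ltnW (ltnW k3))); rewrite !inE.
have nij : i != j.
  by apply: contraFneq (noi i) => ij; rewrite ea eb !inE ij eqxx.
have aH : a \in column i :|: column j by rewrite ea !inE eqxx.
have bH : b \in column i :|: column j by rewrite eb !inE eqxx orbT.
(* Interpolates [a], [b] and [o]; by [q0P] the search succeeds for every point off columns [i] and
   [j]. *)
pose q0 o : R * R * R := if [pick q | [&& a \in graph q setT, b \in graph q setT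
  & o \in graph q setT]] is Some q then q else (0, 0, 0)%R.
have q0P m x : m != i -> m != j ->
    let q := q0 (Some (m, x)) in [/\ y = qv q i, y' = qv q j & x = qv q m].
  move=> nmi nmj; rewrite /q0 ea eb; case: pickP => [q|] /=.
    by rewrite !in_graph !in_setT /= => /and3P[/eqP-> /eqP-> /eqP->].
  rewrite eq_sym in nmi; rewrite eq_sym in nmj.
  have [q [<- <- <-] /(_ q)] := qv_surj y y' x nij nmi nmj.
  by rewrite !in_graph !in_setT !eqxx.
(* Given [a] and [b], a nonzero leading coefficient determines the plane, and [i] is a filler. If it
   is zero, the plane is a triple, determined by the column of [o]. *)
pose phi o := ((q0 o).1.1,
  if (q0 o).1.1 == 0%R then (if o is Some z then z.1 else i) else i).
set S0 := S :&: (column i :|: column j).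
have cS0 : #|S0| <= 1.
  rewrite leqNgt; apply/negP=> /card_gt1P[z [w [/setIP[zS zH] /setIP[wS wH] zw]]].
  exact: (noP z w _ zS wS zw (columns_plane nij)).
set S1 := S :\: (column i :|: column j).
have S1P z : z \in S1 -> exists m x, [/\ z = Some (m, x), m != i, m != j & z \in S].
  case: z => [[m x]|] /setDP[zS]; rewrite !inE // negb_or => /andP[nmi nmj].
  by exists m, x.
have phiI : {in S1 &, injective phi}.
  move=> z w /S1P[m [x [ez mi mj zS]]] /S1P[m' [x' [ew mi' mj' wS]]].
  have [yi yj xm] := q0P m x mi mj; have [yi' yj' xm'] := q0P m' x' mi' mj'.
  rewrite -ez in yi yj xm; rewrite -ew in yi' yj' xm'.
  rewrite /phi => -[eA]; have eq : q0 z = q0 w.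
    by apply: (qv_inj2 nij eA); rewrite -?yi -?yj.
  rewrite eq; case: eqP => [_|/eqP q00 _]; first by rewrite ez ew xm xm' eq => /= ->.
  apply/eqP; apply: contraT => zw; exfalso.
  apply: (noP z w _ zS wS zw (graph_plane q00)).
  - by rewrite ez in_graph in_setT -eq -xm eqxx.
  - by rewrite [X in X \in _]ew in_graph in_setT -xm' eqxx.
  - by rewrite ea in_graph in_setT -yi' eqxx.
  by rewrite eb in_graph in_setT -yj' eqxx.
have sphi : phi @: S1 \subset
    setX [set~ 0%R] [set i] :|: setX [set 0%R] (~: [set i; j]).
  apply/subsetP=> _ /imsetP[z /S1P[m [x [-> mi mj _]]] ->]; rewrite !inE /phi /=.
  by case: eqP => /= _; rewrite ?eqxx // negb_or mi mj.
have cS1 : #|S1| <= #|R|.-1 + (k - 2).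
  rewrite -(card_in_imset phiI) (leq_trans (subset_leq_card sphi)) //.
  rewrite (leq_trans (leq_card_setU _ _)) // !cardsX cardsC1 !cards1 muln1 mul1n.
  by rewrite cardsCs setCK card_ord cards2 nij.
have := cardsID (column i :|: column j) S; rewrite -/S0 -/S1 => <-.
apply: leq_trans (leq_add cS0 cS1) _.
clear -s1 k3; lia.
Qed.

End Quadratics.

(** * The base matroid over the integers modulo [s] and its iterated cones *)

Lemma base_matroid s k l : 1 < s -> 2 < k ->
    (forall d, 0 < d < k -> coprime s d) -> s + k <= l + 3 ->
  exists (T : finType) (M : matroid T) (p : T),
    [/\ rank M = 4, corank2_bound M l.+1, p \in ground M
      & s ^ 2 * (s.-1 + 'C(k, 3)) <= #|[set H in hyperplanes M | p \notin H]|].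
Proof.
(* The nodes are 0, ..., k-1; up to sign their differences are positive integers below [k], hence
   units modulo [s]. *)
move=> s1 k3 cop skl; pose t (i : 'I_k) : 'Z_s := (i%:R)%R.
have t_lt (i j : 'I_k) : i < j -> (t j - t i)%R \is a GRing.unit.
  move=> ij; rewrite -natrB ?(ltnW ij) // unitZpE // cop //.
  by rewrite subn_gt0 ij (leq_ltn_trans (leq_subr _ _)).
have t_unit (i j : 'I_k) : i != j -> (t i - t j)%R \is a GRing.unit.
  by rewrite neq_ltn => /orP[/t_lt|/t_lt //]; rewrite -unitrN opprB.
have cR : #|'Z_s| = s by rewrite card_ord Zp_cast.
exists _, (quadratic_matroid t_unit k3), None; split.
- exact: rank_quadratic_matroid.
- have := @corank2_bound_quadratic_matroid _ _ _ t_unit k3; rewrite cR => /(_ s1) bM A S cA dS iS.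
  by apply: leq_trans (bM A S cA dS iS) _; clear -skl; lia.
- exact: in_setT.
by have := card_hyperplanes_quadratic_matroid t_unit k3; rewrite cR.
Qed.

Lemma tower_matroid (T : finType) (M : matroid T) (p : T) l N n : 0 < l ->
    corank2_bound M l.+1 -> p \in ground M ->
    N <= #|[set H in hyperplanes M | p \notin H]| ->
  exists (T' : finType) (M' : matroid T') (p' : T'),
    [/\ rank M' = rank M + n, corank2_bound M' l.+1, p' \in ground M'
      & N * l ^ n <= #|[set H in hyperplanes M' | p' \notin H]|].
Proof.
move=> l0 bM pM hM; elim: n => [|n [T' [M' [p' [rM' bM' pM' hM']]]]].
  by exists T, M, p; rewrite addn0 muln1.
exists _, (cone M' p' l), (inl p'); split.
- by rewrite rank_cone // rM' addnS.
- exact: corank2_bound_cone.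
- by rewrite inE.
by rewrite expnSr mulnA; apply: card_hyperplanes_cone.
Qed.

(** * Choice of the parameters *)

Definition good_params (s k l : nat) : Prop :=
  [/\ 1 < s, 2 < k, forall d, 0 < d < k -> coprime s d, s + k <= l + 3
    & l * l * l + l * l + l + 2 <= s * s * (s.-1 + 'C(k, 3))].

(** One pair [(s, k)] serves all [l] from [s + k - 3] to [u], since the right side of the count does
    not depend on [l]. Coprimality is a boolean test on a list, so small cases are settled by
    computation. *)
Lemma good_params_range s k c u l : all (coprime s) (iota 1 k.-1) -> 'C(k, 3) = c ->
    1 < s -> 2 < k -> u * u * u + u * u + u + 2 <= s * s * (s.-1 + c) ->
  s + k <= l + 3 -> l <= u -> good_params s k l.
Proof.
move=> /allP cop <- s1 k3 leu skl lu; split=> // [d /andP[d0 dk]|].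
  by apply: cop; rewrite mem_iota d0; case: (k) k3 dk.
by apply: leq_trans leu; rewrite leq_add2r !leq_add ?leq_mul.
Qed.

(* For l >= 64 the parameters are k = 7 and s coprime to 30 with
   l - 9 <= s <= l - 4, the gaps between such s being at most 6; below, each
   (s, k) serves an interval of values of l. *)
Lemma good_params_exist l : 10 <= l -> exists s k, good_params s k l.
Proof.
move=> l10; have [l10'|l11] := leqP l 10.
  by exists 7, 6; apply: (@good_params_range _ _ 20 10); [..| lia | lia | lia].
have [l12|l13] := leqP l 12.
  by exists 7, 7; apply: (@good_params_range _ _ 35 12); [..| lia | lia | lia].
have [l13'|l14] := leqP l 13.
  by exists 11, 5; apply: (@good_params_range _ _ 10 13); [..| lia | lia | lia].
have [l15|l16] := leqP l 15.
  by exists 11, 6; apply: (@good_params_range _ _ 20 15); [..| lia | lia | lia].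
have [l19|l20] := leqP l 19.
  by exists 11, 8; apply: (@good_params_range _ _ 56 19); [..| lia | lia | lia].
have [l27|l28] := leqP l 27.
  by exists 11, 11; apply: (@good_params_range _ _ 165 27); [..| lia | lia | lia].
have [l44|l45] := leqP l 44.
  by exists 17, 13; apply: (@good_params_range _ _ 286 44); [..| lia | lia | lia].
have [l63|l64] := leqP l 63.
  by exists 29, 13; apply: (@good_params_range _ _ 286 63); [..| lia | lia | lia].
have [d d6 cd] : exists2 d, d < 6 & coprime (l - 9 + d) 30.
  (* The gap claim is periodic modulo 30 and is checked on all residues. *)
  pose r := (l - 9) %% 30; have r30 : r < 30 by rewrite ltn_mod.
  have /allP/(_ r) : all (fun r => has (fun d => coprime (r + d) 30) (iota 0 6)) (iota 0 30) by [].
  rewrite mem_iota => /(_ r30)/hasP[d]; rewrite mem_iota => d6 cd.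
  by exists d => //; rewrite -coprime_modl -modnDml coprime_modl.
set s := l - 9 + d in cd; exists s, 7.
have [sl ls] : s + 4 <= l /\ l <= s + 9 by rewrite /s; clear -d6 l64; lia.
have s55 : 55 <= s by clear -ls l64; lia.
apply: (@good_params_range _ _ 35 (s + 9)) => //.
(* The integers from 1 to 6 all divide 60, which has the same prime factors as 30. *)
- apply/allP=> e e7; apply: (@coprime_dvdr _ (30 * 2)); last first.
    by rewrite coprimeMr cd; apply: coprime_dvdr cd.
  have /allP : all (dvdn^~ (30 * 2)) (iota 1 6) by [].
  by apply.
- by apply: leq_trans s55.
(* For [u = s + 9] the claim amounts to [262 * s + 821 <= 6 * s * s], which [55 <= s] ensures. *)
- have h : 55 * s <= s * s by rewrite leq_mul2r s55 orbT.
  clear -s55 h; have -> : s.-1 + 35 = s + 34 by lia.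
  nia.
by clear -sl; lia.
Qed.

Theorem theorem1p2 (r l : nat) (hr : 4 <= r) (hl : 10 <= l) :
  exists (T : finType) (M : matroid T),
    [/\ rank M = r,
        ~ has_minor M (uniform 2 (l + 2)) &
        ((l%:R ^+ r - 1) / (l%:R - 1) < #|hyperplanes M|%:R :> rat)%R].
Proof.
have [s [k [s1 k3 cop skl leN]]] := good_params_exist hl.
have [T [M [p [rM bM pM hM]]]] := base_matroid s1 k3 cop skl.
have l0 : 0 < l by apply: leq_trans hl.
have [T' [M' [p' [rM' bM' _ hM']]]] := tower_matroid (r - 4) l0 bM pM hM.
exists T', M'; split.
- by rewrite rM' rM subnKC.
- by rewrite addn2; apply: no_uniform2_minor.
have l1 : (0 < l%:R - 1 :> rat)%R by rewrite subr_gt0 ltr1n (leq_trans _ hl).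
rewrite ltr_pdivrMr // ltrBlDr -natrX -[(l%:R - 1)%R]/(_ - 1%:R)%R -natrB //.
rewrite -natrM natr1 ltr_nat ltnS -[in l ^ r](subnKC hr) expnD.
have hN : (l * l * l + l * l + l + 2) * l ^ (r - 4) <= #|hyperplanes M'|.
  apply: leq_trans (leq_trans hM' _); last first.
    by apply/subset_leq_card/subsetP=> H; rewrite inE => /andP[].
  by rewrite leq_mul2r mulnn leN orbT.
(* The product of [l^3 + l^2 + l + 2] and [l - 1] is [l^4 + l - 2], at least [l^4]; with 1 in place
   of 2 it would be only [l^4 - 1]. *)
apply: leq_trans (leq_mul hN (leqnn (l - 1))).
rewrite mulnAC leq_mul2r; apply/orP; right.
have -> : l ^ 4 = l * l * l * l by rewrite !expnS expn0 muln1 !mulnA.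
clear -hl; case: l hl => // l hl; rewrite subn1 /=; nia.
Qed.
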